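(* Let $\langle X\mid R\rangle$ be a presentation with balanced relators, with $X$ finite, and let $\varphi\colon\mathcal{O}\hookrightarrow U$ be a continuous open monomorphism of topological groups, where $\mathcal{O}$ is an open subgroup of $U$. Then $\mathcal{O}=U$ and $\varphi$ is surjective if and only if $\langle\langle U\rangle\rangle_{G_\varphi}=U$ in $G_\varphi$.
   Context: All topological groups are Hausdorff. A continuous open monomorphism is an injective group homomorphism that is continuous and open. For a finite set $X$, $\mathcal{H}_X(\varphi)=(U*F(X))/\langle\langle t\omega t^{-1}\varphi(\omega)^{-1}\mid t\in X,\ \omega\in\mathcal{O}\rangle\rangle$, where $F(X)$ is the free group on $X$, endowed with the unique group topology making the canonical embedding $U\hookrightarrow\mathcal{H}_X(\varphi)$ continuous and open. For a presentation $\langle X\mid R\rangle$ with $X$ finite, $G_\varphi:=\mathcal{H}_X(\varphi)/\langle\langle R\rangle\rangle$, with the quotient topology. The presentation has balanced relators if every $r\in R$ lies in the kernel of the homomorphism $F(X)\to\mathbb{Z}$ sending each $x\in X$ to $1$; in this case the canonical map $U\to G_\varphi$ is injective, and $U$ is identified with its image, an open subgroup of $G_\varphi$. $\langle\langle U\rangle\rangle_{G_\varphi}$ denotes the normal closure of $U$ in $G_\varphi$.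
   Formalization: The finite set X is assumed non-empty; for empty X the claim fails, since then G_φ = U and ⟨⟨U⟩⟩ = U always holds, e.g. for U = Z/2 discrete with O trivial and φ the inclusion. *)

(* Defs.v *)
From HB Require Import structures.
From mathcomp Require Import all_boot all_order all_algebra.
From mathcomp Require Import all_classical.
From mathcomp Require Import topology.

Set Implicit Arguments.
Unset Strict Implicit.
Unset Printing Implicit Defensive.

Import Order.TTheory GRing.Theory.

Local Open Scope classical_set_scope.
Local Open Scope quotient_scope.
Local Open Scope group_scope.

HB.mixin Record isTopologicalGroup G of Group G & Topological G := {
  mulg_continuous : continuous (fun xy : G * G => xy.1 * xy.2);
  invg_continuous : continuous (fun x : G => x^-1)
}.

#[short(type="topologicalGroupType")]
HB.structure Definition TopologicalGroup :=
  {G of isTopologicalGroup G & Group G & Topological G}.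

Section Subgroups.
Variable G : groupType.
Implicit Types (H S : set G).

Definition subgroup H :=
  [/\ H 1, forall x y, H x -> H y -> H (x * y) & forall x, H x -> H x^-1].

Definition normal_subgroup H := subgroup H /\ forall x y, H x -> H (x ^ y).

Definition normal_closure S : set G := smallest normal_subgroup S.

Lemma sub_normal_closure S : S `<=` normal_closure S.
Proof. by move=> x Sx H [_]; apply. Qed.

Lemma normal_closure_min S H :
  normal_subgroup H -> S `<=` H -> normal_closure S `<=` H.
Proof. by move=> nH SH x /(_ H); apply. Qed.

Lemma normal_closure_normal S : normal_subgroup (normal_closure S).
Proof.
split; first split.
- by move=> H [[[]]].
- by move=> x y Nx Ny H HS; case: (HS) => -[[_ HM _] _] _; apply: HM;
    [exact: (Nx H HS) | exact: (Ny H HS)].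
- by move=> x Nx H HS; case: (HS) => -[[_ _ HV] _] _; apply: HV (Nx H HS).
- by move=> x y Nx H HS; case: (HS) => -[_ HJ] _; apply: HJ (Nx H HS).
Qed.

End Subgroups.

Lemma morphM1 (G H : groupType) (f : G -> H) :
  {morph f : x y / x * y} -> f 1 = 1.
Proof. by move=> fM; apply: (mulgI (f 1)); rewrite -fM !mulg1. Qed.

Lemma subgroup_preimage (G H : groupType) (f : UMagmaMorphism.type G H)
  (K : set H) : subgroup K -> subgroup (f @^-1` K).
Proof.
move=> [K1 KM KV]; split=> /=; first by rewrite gmulf1.
- by move=> x y Kx Ky; rewrite /= gmulfM; apply: KM.
- by move=> x Kx; rewrite /= gmulfV; apply: KV.
Qed.

Section QuotientGroup.
Variables (G : groupType) (S : set G).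
Local Notation N := (normal_closure S).

Let N1 : N 1. Proof. by have [[]] := normal_closure_normal S. Qed.
Let NM x y : N x -> N y -> N (x * y).
Proof. by have [[_ + _] _] := normal_closure_normal S; exact. Qed.
Let NV x : N x -> N x^-1.
Proof. by have [[_ _ +] _] := normal_closure_normal S; exact. Qed.
Let NJ x y : N x -> N (x ^ y).
Proof. by have [_] := normal_closure_normal S; exact. Qed.

Definition coset_rel (x y : G) : bool := `[< N (x^-1 * y) >].

Lemma coset_rel_refl : reflexive coset_rel.
Proof. by move=> x; apply/asboolP; rewrite mulVg. Qed.

Lemma coset_rel_sym : symmetric coset_rel.
Proof.
by move=> x y; apply/asboolP/asboolP => /NV; rewrite invgM invgK.
Qed.

Lemma coset_rel_trans : transitive coset_rel.
Proof.
move=> y x z /asboolP xy /asboolP yz; apply/asboolP.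
by have := NM xy yz; rewrite -mulgA mulVKg.
Qed.

Definition coset_equiv : equiv_rel G :=
  EquivRel coset_rel coset_rel_refl coset_rel_sym coset_rel_trans.

(* S is an arbitrary set: the quotient is by its normal closure. *)
Definition quot_group : Type := {eq_quot coset_equiv}.
HB.instance Definition _ := Choice.on quot_group.
HB.instance Definition _ := EqQuotient.on quot_group.

Definition quot_proj (x : G) : quot_group := \pi x.

Lemma quot_projP x y : quot_proj x = quot_proj y <-> N (x^-1 * y).
Proof.
split=> [/eqquotP|xy]; first by move=> /asboolP.
by apply/eqquotP/asboolP.
Qed.

Lemma quot_proj_surj (a : quot_group) : exists x, quot_proj x = a.
Proof. by exists (repr a); rewrite /quot_proj reprK. Qed.

Definition quot_mul (a b : quot_group) : quot_group :=
  quot_proj (repr a * repr b).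
Definition quot_inv (a : quot_group) : quot_group := quot_proj (repr a)^-1.

Lemma repr_quot_proj x : N ((repr (quot_proj x))^-1 * x).
Proof. by apply/quot_projP; rewrite /quot_proj reprK. Qed.

Lemma quot_mulE x y :
  quot_mul (quot_proj x) (quot_proj y) = quot_proj (x * y).
Proof.
apply/quot_projP; rewrite invgM.
have Nx := repr_quot_proj x; have Ny := repr_quot_proj y.
set a := repr (quot_proj x) in Nx *; set b := repr (quot_proj y) in Ny *.
have -> : b^-1 * a^-1 * (x * y) = (b^-1 * y) * (a^-1 * x) ^ y.
  by rewrite conjgE !mulgA mulgK.
by apply: NM => //; apply: NJ.
Qed.

Lemma quot_invE x : quot_inv (quot_proj x) = quot_proj x^-1.
Proof.
apply/quot_projP; rewrite invgK.
have /NV/(NJ x^-1) := repr_quot_proj x.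
by rewrite conjgE !invgM !invgK !mulgA mulgV mul1g.
Qed.

Lemma quot_mulA : associative quot_mul.
Proof.
move=> a b c; have [x <-] := quot_proj_surj a.
have [y <-] := quot_proj_surj b; have [z <-] := quot_proj_surj c.
by rewrite !quot_mulE mulgA.
Qed.

Lemma quot_mul1 : left_id (quot_proj 1) quot_mul.
Proof. by move=> a; have [x <-] := quot_proj_surj a; rewrite quot_mulE mul1g. Qed.

Lemma quot_mulr1 : right_id (quot_proj 1) quot_mul.
Proof. by move=> a; have [x <-] := quot_proj_surj a; rewrite quot_mulE mulg1. Qed.

Lemma quot_mulV : left_inverse (quot_proj 1) quot_inv quot_mul.
Proof.
by move=> a; have [x <-] := quot_proj_surj a; rewrite quot_invE quot_mulE mulVg.
Qed.

Lemma quot_mulVr : right_inverse (quot_proj 1) quot_inv quot_mul.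
Proof.
by move=> a; have [x <-] := quot_proj_surj a; rewrite quot_invE quot_mulE mulgV.
Qed.

HB.instance Definition _ := isGroup.Build quot_group
  quot_mulA quot_mul1 quot_mulr1 quot_mulV quot_mulVr.

Lemma quot_projM : {morph quot_proj : x y / x * y}.
Proof. by move=> x y; rewrite -quot_mulE. Qed.

HB.instance Definition _ := isUMagmaMorphism.Build G quot_group quot_proj
  (erefl, quot_projM).

Lemma quot_projV : {morph quot_proj : x / x^-1}.
Proof. by move=> x; rewrite -quot_invE. Qed.

Lemma quot_proj_rel x : S x -> quot_proj x = 1.
Proof.
move=> Sx; apply/esym/quot_projP; rewrite invg1 mul1g.
exact: sub_normal_closure.
Qed.

End QuotientGroup.

Section FreeGroup.
Variable X : choiceType.

(* The letter (x, b) stands for x if b = false and for x^-1 if b = true. *)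
Definition letter_inv (l : X * bool) := (l.1, ~~ l.2).

Inductive free_eqv : seq (X * bool) -> seq (X * bool) -> Prop :=
| free_eqv_refl s : free_eqv s s
| free_eqv_sym s t : free_eqv s t -> free_eqv t s
| free_eqv_trans s t u : free_eqv s t -> free_eqv t u -> free_eqv s u
| free_eqv_cancel s1 l s2 :
    free_eqv (s1 ++ [:: l; letter_inv l] ++ s2) (s1 ++ s2).

Definition free_rel (s t : seq (X * bool)) : bool := `[< free_eqv s t >].

Lemma free_rel_refl : reflexive free_rel.
Proof. by move=> s; apply/asboolP/free_eqv_refl. Qed.

Lemma free_rel_sym : symmetric free_rel.
Proof. by move=> s t; apply/asboolP/asboolP; apply: free_eqv_sym. Qed.

Lemma free_rel_trans : transitive free_rel.
Proof.
by move=> t s u /asboolP st /asboolP tu; apply/asboolP/(free_eqv_trans st).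
Qed.

Definition free_equiv : equiv_rel (seq (X * bool)) :=
  EquivRel free_rel free_rel_refl free_rel_sym free_rel_trans.

Definition free_group : Type := {eq_quot free_equiv}.
HB.instance Definition _ := Choice.on free_group.
HB.instance Definition _ := EqQuotient.on free_group.

Definition free_word (s : seq (X * bool)) : free_group := \pi s.

Definition free_gen (x : X) : free_group := free_word [:: (x, false)].

Lemma free_wordP s t : free_word s = free_word t <-> free_eqv s t.
Proof.
split=> [/eqquotP|st]; first by move=> /asboolP.
by apply/eqquotP/asboolP.
Qed.

Lemma free_word_surj (a : free_group) : exists s, free_word s = a.
Proof. by exists (repr a); rewrite /free_word reprK. Qed.

Lemma free_eqv_cat s s' t t' :
  free_eqv s s' -> free_eqv t t' -> free_eqv (s ++ t) (s' ++ t').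
Proof.
move=> ss' tt'; apply: (@free_eqv_trans _ (s' ++ t)).
  elim: ss' => [u|u v _|u v w _ uv _|s1 l s2].
  - exact: free_eqv_refl.
  - exact: free_eqv_sym.
  - exact: free_eqv_trans.
  - by rewrite -!catA; apply: free_eqv_cancel.
elim: tt' => [u|u v _|u v w _ uv _|s1 l s2].
- exact: free_eqv_refl.
- exact: free_eqv_sym.
- exact: free_eqv_trans.
- by rewrite !(catA s'); apply: free_eqv_cancel.
Qed.

Definition word_inv (s : seq (X * bool)) := rev (map letter_inv s).

Lemma letter_invK : involutive letter_inv.
Proof. by case=> x b; rewrite /letter_inv /= negbK. Qed.

Lemma word_invK : involutive word_inv.
Proof.
move=> s; rewrite /word_inv map_rev revK -map_comp.
by rewrite (eq_map (g := id)) ?map_id // => l; apply: letter_invK.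
Qed.

Lemma free_eqv_mulV s : free_eqv (s ++ word_inv s) [::].
Proof.
elim: s => [|l s IHs]; first exact: free_eqv_refl.
have -> : (l :: s) ++ word_inv (l :: s) =
    [:: l] ++ (s ++ word_inv s) ++ [:: letter_inv l].
  by rewrite /word_inv /= rev_cons -cats1 catA.
apply: (@free_eqv_trans _ ([:: l] ++ [::] ++ [:: letter_inv l])).
  by do 2![apply: free_eqv_cat => //; try exact: free_eqv_refl].
exact: (free_eqv_cancel [::] l [::]).
Qed.

Lemma free_eqv_mulVl s : free_eqv (word_inv s ++ s) [::].
Proof. by rewrite -{2}[s]word_invK; apply: free_eqv_mulV. Qed.

Lemma free_eqv_inv s t : free_eqv s t -> free_eqv (word_inv s) (word_inv t).
Proof.
move=> st; apply: (@free_eqv_trans _ (word_inv s ++ t ++ word_inv t)).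
  rewrite -[X in free_eqv X _]cats0; apply: free_eqv_cat.
    exact: free_eqv_refl.
  exact/free_eqv_sym/free_eqv_mulV.
rewrite catA -[X in free_eqv _ X]cat0s; apply: free_eqv_cat.
  apply: free_eqv_trans (free_eqv_mulVl s).
  by apply: free_eqv_cat; [apply: free_eqv_refl | apply: free_eqv_sym].
exact: free_eqv_refl.
Qed.

Definition free_mul (a b : free_group) := free_word (repr a ++ repr b).
Definition free_inv (a : free_group) := free_word (word_inv (repr a)).

Lemma repr_free_word s : free_eqv (repr (free_word s)) s.
Proof. by apply/free_wordP; rewrite /free_word reprK. Qed.

Lemma free_mulE s t : free_mul (free_word s) (free_word t) = free_word (s ++ t).
Proof. by apply/free_wordP/free_eqv_cat; apply: repr_free_word. Qed.

Lemma free_invE s : free_inv (free_word s) = free_word (word_inv s).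
Proof. by apply/free_wordP/free_eqv_inv/repr_free_word. Qed.

Lemma free_mulA : associative free_mul.
Proof.
move=> a b c; have [x <-] := free_word_surj a.
have [y <-] := free_word_surj b; have [z <-] := free_word_surj c.
by rewrite !free_mulE catA.
Qed.

Lemma free_mul1 : left_id (free_word [::]) free_mul.
Proof. by move=> a; have [x <-] := free_word_surj a; rewrite free_mulE. Qed.

Lemma free_mulr1 : right_id (free_word [::]) free_mul.
Proof. by move=> a; have [x <-] := free_word_surj a; rewrite free_mulE cats0. Qed.

Lemma free_mulV : left_inverse (free_word [::]) free_inv free_mul.
Proof.
move=> a; have [x <-] := free_word_surj a; rewrite free_invE free_mulE.
exact/free_wordP/free_eqv_mulVl.
Qed.

Lemma free_mulVr : right_inverse (free_word [::]) free_inv free_mul.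
Proof.
move=> a; have [x <-] := free_word_surj a; rewrite free_invE free_mulE.
exact/free_wordP/free_eqv_mulV.
Qed.

HB.instance Definition _ := isGroup.Build free_group
  free_mulA free_mul1 free_mulr1 free_mulV free_mulVr.

Lemma free_word_cat s t : free_word (s ++ t) = free_word s * free_word t.
Proof. by rewrite -free_mulE. Qed.

Lemma free_word_inv s : free_word (word_inv s) = (free_word s)^-1.
Proof. by rewrite -free_invE. Qed.

Lemma free_group_ind (H : set free_group) :
  subgroup H -> (forall x, H (free_gen x)) -> H = setT.
Proof.
move=> [H1 HM HV] Hg; apply/seteqP; split=> // a _.
have [s <-] := free_word_surj a; elim: s => [//|[x b] s IHs].
rewrite -cat1s free_word_cat; apply: HM => //.
case: b; last exact: Hg.
by rewrite -[[:: _]]/(word_inv [:: (x, false)]) free_word_inv; apply/HV/Hg.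
Qed.

Definition word_exponent_sum (s : seq (X * bool)) : int :=
  (\sum_(l <- s) (if l.2 then -1 else 1))%R.

(* The homomorphism from the free group to Z sending every generator to 1,
   see [exponent_sumM] and [exponent_sum_gen]. *)
Definition exponent_sum (a : free_group) : int := word_exponent_sum (repr a).

Lemma exponent_sum_word s : exponent_sum (free_word s) = word_exponent_sum s.
Proof.
rewrite /exponent_sum; move: (repr _) (repr_free_word s) => t; elim=> //.
- by move=> u v w _ -> _ ->.
- move=> s1 l s2; rewrite /word_exponent_sum !big_cat /= !big_cons big_nil addr0.
  by case: l => x [] /=; rewrite ?(addNr, subrr) add0r.
Qed.

Lemma exponent_sumM a b :
  exponent_sum (a * b) = (exponent_sum a + exponent_sum b)%R.
Proof.
have [s <-] := free_word_surj a; have [t <-] := free_word_surj b.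
by rewrite -free_word_cat !exponent_sum_word /word_exponent_sum big_cat.
Qed.

Lemma exponent_sum_gen x : exponent_sum (free_gen x) = 1%R.
Proof. by rewrite exponent_sum_word /word_exponent_sum big_seq1. Qed.

Definition balanced_relators (R : set free_group) :=
  forall r, R r -> exponent_sum r = 0%R.

End FreeGroup.

Section FreeProduct.
Variables A B : groupType.

(* The free product is presented by the disjoint union of the two groups as
   generators and the two multiplication tables as relators. *)
Definition free_prod_relators : set (free_group (A + B)%type) :=
  [set free_gen (inl a) * free_gen (inl a') * (free_gen (inl (a * a')))^-1
     | a in [set: A] & a' in [set: A]] `|`
  [set free_gen (inr b) * free_gen (inr b') * (free_gen (inr (b * b')))^-1
     | b in [set: B] & b' in [set: B]].

Definition free_prod : Type := quot_group free_prod_relators.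
HB.instance Definition _ := Group.on free_prod.

Definition free_prod_inl (a : A) : free_prod := quot_proj _ (free_gen (inl a)).
Definition free_prod_inr (b : B) : free_prod := quot_proj _ (free_gen (inr b)).

Lemma free_prod_inlM : {morph free_prod_inl : a a' / a * a'}.
Proof.
move=> a a'.
have /quot_proj_rel : free_prod_relators
    (free_gen (inl a) * free_gen (inl a') * (free_gen (inl (a * a')))^-1).
  by left; exists a => //; exists a'.
by rewrite 2!quot_projM quot_projV => /divg1_eq.
Qed.

Lemma free_prod_inrM : {morph free_prod_inr : b b' / b * b'}.
Proof.
move=> b b'.
have /quot_proj_rel : free_prod_relators
    (free_gen (inr b) * free_gen (inr b') * (free_gen (inr (b * b')))^-1).
  by right; exists b => //; exists b'.
by rewrite 2!quot_projM quot_projV => /divg1_eq.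
Qed.

HB.instance Definition _ := isUMagmaMorphism.Build A free_prod free_prod_inl
  (morphM1 free_prod_inlM, free_prod_inlM).
HB.instance Definition _ := isUMagmaMorphism.Build B free_prod free_prod_inr
  (morphM1 free_prod_inrM, free_prod_inrM).

Lemma free_prod_ind (H : set free_prod) : subgroup H ->
  (forall a, H (free_prod_inl a)) -> (forall b, H (free_prod_inr b)) -> H = setT.
Proof.
move=> sH Hl Hr; apply/seteqP; split=> // c _.
have [w <-] := quot_proj_surj c.
suff E : @quot_proj _ free_prod_relators @^-1` H = setT.
  by have : [set: free_group (A + B)%type] w by []; rewrite -E.
apply: free_group_ind => [|[]//].
exact: subgroup_preimage.
Qed.

End FreeProduct.

Lemma topological_group_openM (U : topologicalGroupType) (u : U) (V : set U) :
  open V -> open [set v | V (u * v)].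
Proof.
move=> oV; suff /continuousP/(_ V oV) : continuous (fun v : U => u * v) by [].
move=> v; apply: (@continuous_comp _ _ _ (pair u) (fun xy : U * U => xy.1 * xy.2)).
  by apply: cvg_pair; [exact: cvg_cst | exact: cvg_id].
exact: mulg_continuous.
Qed.

(* A map phi : O -> U is represented by a total function phi : U -> U of which
   only the values on O matter. For O open, the open subsets of the subspace O
   are the open subsets of U contained in O. *)
Definition continuous_open_mono (U : topologicalGroupType) (O : set U)
    (phi : U -> U) : Prop :=
  [/\ {in O &, {morph phi : x y / x * y}}, {in O &, injective phi},
      {within O, continuous phi} &
      forall V, open V -> V `<=` O -> open (phi @` V)].

Section HNN.
Variables (X : choiceType) (U : topologicalGroupType).
Variables (O : set U) (phi : U -> U).

Definition HNN_relators : set (free_prod U (free_group X)) :=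
  [set free_prod_inr U (free_gen t) * free_prod_inl (free_group X) w *
       (free_prod_inr U (free_gen t))^-1 *
       (free_prod_inl (free_group X) (phi w))^-1
     | t in [set: X] & w in O].

Definition HNN : Type := quot_group HNN_relators.
HB.instance Definition _ := Group.on HNN.

Definition HNN_base (u : U) : HNN := quot_proj _ (free_prod_inl _ u).
Definition HNN_free (w : free_group X) : HNN := quot_proj _ (free_prod_inr _ w).

Lemma HNN_baseM : {morph HNN_base : u v / u * v}.
Proof. by move=> u v; rewrite /HNN_base gmulfM quot_projM. Qed.

Lemma HNN_freeM : {morph HNN_free : u v / u * v}.
Proof. by move=> u v; rewrite /HNN_free gmulfM quot_projM. Qed.

HB.instance Definition _ := isUMagmaMorphism.Build U HNN HNN_base
  (morphM1 HNN_baseM, HNN_baseM).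
HB.instance Definition _ := isUMagmaMorphism.Build (free_group X) HNN HNN_free
  (morphM1 HNN_freeM, HNN_freeM).

Lemma HNN_rel t w : O w ->
  HNN_base w ^ (HNN_free (free_gen t))^-1 = HNN_base (phi w).
Proof.
move=> Ow; have /quot_proj_rel : HNN_relators
    (free_prod_inr U (free_gen t) * free_prod_inl (free_group X) w *
     (free_prod_inr U (free_gen t))^-1 *
     (free_prod_inl (free_group X) (phi w))^-1) by exists t => //; exists w.
by rewrite 3!quot_projM !quot_projV /conjg invgK !mulgA => /divg1_eq.
Qed.

Lemma HNN_ind (K : set HNN) : subgroup K ->
  (forall u, K (HNN_base u)) -> (forall t, K (HNN_free (free_gen t))) -> K = setT.
Proof.
move=> sK Ku Kt; apply/seteqP; split=> // c _.
have [w <-] := quot_proj_surj c.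
suff E : @quot_proj _ HNN_relators @^-1` K = setT.
  by have : [set: free_prod U (free_group X)] w by []; rewrite -E.
apply: free_prod_ind => //; first exact: subgroup_preimage.
move=> b; suff E : HNN_free @^-1` K = setT.
  by have : [set: free_group X] b by []; rewrite -E.
by apply: free_group_ind => //; exact: subgroup_preimage.
Qed.

(* The topology for which the sets h HNN_base(V), with V open in U, form a
   base. When phi is a continuous open monomorphism on an open subgroup O, it is
   the unique group topology making HNN_base continuous and open: see
   [HNN_base_continuous], [HNN_base_open], [HNN_mulg_continuous],
   [HNN_invg_continuous] and [HNN_topology_unique]. *)
Definition HNN_open (W : set HNN) :=
  forall h : HNN, open [set u | W (h * HNN_base u)].

Lemma HNN_openT : HNN_open setT.
Proof. by move=> h; exact: openT. Qed.

Lemma HNN_openI : setI_closed HNN_open.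
Proof. by move=> V W oV oW h; apply: openI (oV h) (oW h). Qed.

Lemma HNN_open_bigU (I : Type) (f : I -> set HNN) :
  (forall i, HNN_open (f i)) -> HNN_open (\bigcup_i f i).
Proof.
move=> of_ h; have := @bigcup_open U I setT
  (fun i => [set u | f i (h * HNN_base u)]) (fun i _ => of_ i h).
by congr open; apply/seteqP; split => u [i].
Qed.

HB.instance Definition _ :=
  isOpenTopological.Build HNN HNN_openT HNN_openI HNN_open_bigU.

Lemma HNN_openE (W : set HNN) :
  open W <-> forall h : HNN, open [set u | W (h * HNN_base u)].
Proof. by []. Qed.

Lemma HNN_base_continuous : continuous HNN_base.
Proof.
apply/continuousP => W oW.
rewrite (_ : _ @^-1` W = [set u | W (1 * HNN_base u)]); first exact: oW.
by apply/seteqP; split=> u; rewrite /= mul1g.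
Qed.

Lemma HNN_base_open (g : HNN) (V : set U) :
  open V -> open [set g * HNN_base v | v in V].
Proof.
move=> oV; apply/HNN_openE => h; rewrite openE => u [v Vv gv].
rewrite /interior nbhsE; exists [set w | V (v * u^-1 * w)]; first split.
- exact: topological_group_openM.
- by rewrite /= mulgVK.
- move=> w Vw; exists (v * u^-1 * w) => //.
  by rewrite 2!gmulfM gmulfV !mulgA gv mulgK.
Qed.

Lemma HNN_nbhsP (g : HNN) (W : set HNN) :
  nbhs g W <->
  exists V : set U, [/\ open V, V 1 & forall v, V v -> W (g * HNN_base v)].
Proof.
split=> [|[V [oV V1 VW]]].
  rewrite nbhsE => -[W' [oW' W'g W'W]].
  exists [set u | W' (g * HNN_base u)]; split=> [|/=|v /W'W//]; first exact: oW'.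
  by rewrite gmulf1 mulg1.
rewrite nbhsE; exists [set g * HNN_base v | v in V]; last by move=> _ [v /VW ? <-].
by split; [exact: HNN_base_open | exists 1; rewrite ?gmulf1 ?mulg1].
Qed.

Section HNN_group_topology.
Hypotheses (sO : subgroup O) (oO : open O) (phiP : continuous_open_mono O phi).

Let small_conj (h : HNN) := forall V : set U, open V -> V 1 ->
  exists V' : set U, [/\ open V', V' 1 &
    forall u, V' u -> exists2 v, V v & HNN_base u ^ h = HNN_base v].

Let small_conjM h h' : small_conj h -> small_conj h' -> small_conj (h * h').
Proof.
move=> sh sh' V oV V1; have [V' [oV' V'1 V'V]] := sh' V oV V1.
have [V'' [oV'' V''1 V''V']] := sh V' oV' V'1.
exists V''; split=> // u /V''V'[v /V'V[w Vw vw] uv].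
by exists w; rewrite // conjgM uv.
Qed.

Let phi1 : phi 1 = 1.
Proof.
have [phiM _ _ _] := phiP; have [O1 _ _] := sO.
by apply: (mulgI (phi 1)); rewrite -phiM ?inE // !mulg1.
Qed.

Let small_conj_base u : small_conj (HNN_base u).
Proof.
move=> V oV V1; exists [set w | V (w ^ u)]; split; last first.
- by move=> w Vw; exists (w ^ u); rewrite // /conjg !gmulfM gmulfV.
- by rewrite /= conj1g.
suff /continuousP/(_ V oV) : continuous (fun w : U => w ^ u) by [].
move=> w; apply: (@continuous_comp _ _ _ (fun w => (u^-1, w * u))
                                        (fun xy : U * U => xy.1 * xy.2)).
  apply: cvg_pair; first exact: cvg_cst.
  apply: (@continuous_comp _ _ _ (fun w => (w, u)) (fun xy : U * U => xy.1 * xy.2)).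
    by apply: cvg_pair; [exact: cvg_id | exact: cvg_cst].
  exact: mulg_continuous.
exact: mulg_continuous.
Qed.

Let small_conj_gen t : small_conj (HNN_free (free_gen t)).
Proof.
move=> V oV V1; have [_ _ _ phi_open] := phiP; have [O1 _ _] := sO.
exists (phi @` (O `&` V)); split.
- by apply: phi_open => [|u []//]; exact: openI.
- by exists 1; rewrite ?phi1.
- by move=> _ [w [Ow Vw] <-]; exists w; rewrite // -(HNN_rel t Ow) conjgKV.
Qed.

Let small_conj_genV t : small_conj (HNN_free (free_gen t))^-1.
Proof.
move=> V oV V1; have [_ _ phi_cont _] := phiP; have [O1 _ _] := sO.
exists (O `&` phi @^-1` V); split.
- move/(@continuousP (subspace O)): phi_cont => /(_ V oV) /open_subspaceP.
  by move=> [V' oV' E]; rewrite setIC -E; exact: openI.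
- by split; rewrite /= ?phi1.
- by move=> w [Ow Vw]; exists (phi w) => //; exact: HNN_rel.
Qed.

Let small_conjT h : small_conj h.
Proof.
suff E : [set h | small_conj h /\ small_conj h^-1] = setT.
  by have : [set: HNN] h by []; rewrite -E => -[].
apply: HNN_ind => [|u|t] /=.
- split=> [|x y [sx sxV] [sy syV]|x [sx sxV]] /=.
  + rewrite invg1; split=> V oV V1; exists V; split=> // u Vu;
    by exists u; rewrite ?conjg1.
  + by rewrite invgM; split; exact: small_conjM.
  + by rewrite invgK.
- by rewrite -gmulfV; split; exact: small_conj_base.
- by split; [exact: small_conj_gen | exact: small_conj_genV].
Qed.

Let open_mul (V : set U) : open V -> V 1 ->
  exists V' : set U, [/\ open V', V' 1 & forall u v, V' u -> V' v -> V (u * v)].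
Proof.
move=> oV V1; have := @mulg_continuous U (1, 1); rewrite /continuous_at /= mulg1.
move=> /(_ V (open_nbhs_nbhs (conj oV V1))) [[A B] /= [nA nB] AB].
move: nA nB; rewrite !nbhsE => -[A' [oA' A'1 A'A]] [B' [oB' B'1 B'B]].
exists (A' `&` B'); split; [exact: openI | by [] |].
by move=> u v [/A'A Au _] [_ /B'B Bv]; apply: (AB (u, v)).
Qed.

Lemma HNN_mulg_continuous : continuous (fun xy : HNN * HNN => xy.1 * xy.2).
Proof.
move=> [g h] W /HNN_nbhsP[V [oV V1 VW]] /=.
have [V' [oV' V'1 V'V]] := open_mul oV V1.
have [V'' [oV'' V''1 V''V']] := small_conjT h oV' V'1.
exists ([set g * HNN_base v | v in V''], [set h * HNN_base v | v in V']) => /=.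
  by split; apply/HNN_nbhsP; [exists V'' | exists V']; split=> // v Vv; exists v.
move=> [_ _] [/= [u V''u <-] [v V'v <-]].
have [w V'w uw] := V''V' u V''u.
rewrite (_ : _ * _ = g * h * HNN_base (w * v)); first exact/VW/V'V.
by rewrite gmulfM /= -uw /conjg !mulgA mulgK.
Qed.

Lemma HNN_invg_continuous : continuous (fun x : HNN => x^-1).
Proof.
move=> g W /HNN_nbhsP[V [oV V1 VW]] /=.
have oV' : open [set u : U | V u^-1].
  by move/continuousP : (@invg_continuous U) => /(_ V oV).
have [|V'' [oV'' V''1 V''V']] := small_conjT g^-1 oV'; first by rewrite /= invg1.
apply/HNN_nbhsP; exists V''; split=> // u /V''V'[v /VW + uv].
by rewrite /= gmulfV /= -uv /conjg !invgM !invgK !mulgA mulVg mul1g.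
Qed.

End HNN_group_topology.

Lemma HNN_topology_unique (T : topologicalGroupType)
    (f : {multiplicative HNN -> T}) :
  bijective f -> continuous (f \o HNN_base) ->
  (forall V : set U, open V -> open ((f \o HNN_base) @` V)) ->
  forall W : set HNN, open W <-> open (f @` W).
Proof.
move=> fB f_cont f_open W; split=> [/HNN_openE oW|oW].
  rewrite (_ : f @` W = \bigcup_(h in [set: HNN])
    ((fun y => (f h)^-1 * y) @^-1`
      ((f \o HNN_base) @` [set u | W (h * HNN_base u)]))).
    by apply: bigcup_open => h _; apply/topological_group_openM/f_open.
  apply/seteqP; split=> [_ [h Wh <-]|y [h _ [u /= Wu E]]].
    exists h => //; exists 1; rewrite /= ?gmulf1 ?mulg1 ?mulVg //.
    exact: morphM1 (@gmulfM _ _ f).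
  by exists (h * HNN_base u); rewrite // gmulfM E mulVKg.
apply/HNN_openE => h.
have /continuousP/(_ _ (topological_group_openM (f h) oW)) := f_cont.
congr open; apply/seteqP; split=> u /=; rewrite -gmulfM.
  by move=> [g Wg /(bij_inj fB) <-].
by move=> Wu; exists (h * HNN_base u).
Qed.

End HNN.

Section Gphi.
Variables (X : choiceType) (R : set (free_group X)) (U : topologicalGroupType).
Variables (O : set U) (phi : U -> U).
Local Notation H := (HNN X O phi).

Definition Gphi : Type := quot_group (@HNN_free X U O phi @` R).
HB.instance Definition _ := Group.on Gphi.

Definition Gphi_open (W : set Gphi) :=
  open [set h : H | W (quot_proj _ h)].

Lemma Gphi_openT : Gphi_open setT.
Proof. exact: openT. Qed.

Lemma Gphi_openI : setI_closed Gphi_open.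
Proof. by move=> V W oV oW; exact: openI oV oW. Qed.

Lemma Gphi_open_bigU (I : Type) (f : I -> set Gphi) :
  (forall i, Gphi_open (f i)) -> Gphi_open (\bigcup_i f i).
Proof.
move=> of_; have := @bigcup_open H I setT
  (fun i => [set h : H | f i (quot_proj _ h)]) (fun i _ => of_ i).
by congr open; apply/seteqP; split => u [i].
Qed.

HB.instance Definition _ :=
  isOpenTopological.Build Gphi Gphi_openT Gphi_openI Gphi_open_bigU.

Definition Gphi_base (u : U) : Gphi := quot_proj _ (HNN_base X O phi u).

End Gphi.

(* Main.v *)
Require Import Defs.
From HB Require Import structures.
From mathcomp Require Import all_boot all_order all_algebra.
From mathcomp Require Import all_classical.
From mathcomp Require Import topology.

Set Implicit Arguments.
Unset Strict Implicit.
Unset Printing Implicit Defensive.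

Local Open Scope classical_set_scope.
Local Open Scope group_scope.

(** If [O = U] and [phi] is onto, every stable letter normalizes [U], so [U] is
    normal. Conversely, since the relators are balanced, sending every stable
    letter to the same element [t] of a group [K] maps [Gphi] to [K] as soon as
    [U] maps to [K] in such a way that [t] conjugates [w] to [phi w] for [w] in
    [O]. Take for [K] the permutations of [U * A^nat * B^nat], where [A] and [B]
    are right transversals of [O] and of [P = phi(O)]: [U] acts on the first
    factor by translation, and [t] moves a two-sided tape by one cell,
    [(o a, f, b :: g) |-> (phi(o) b, a :: f, g)] with [o] in [O]. At a constant
    tape one reads off that [t u t^-1] belongs to [U] only if [u] belongs to
    [O], and [t^-1 u t] only if [u] belongs to [P]. *)

(** * The group of permutations of a type *)

Section Bijections.
Variable T : Type.

Record bijection := Bijection {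
  bij_fun : T -> T;
  bij_inv : T -> T;
  bij_funK : cancel bij_fun bij_inv;
  bij_invK : cancel bij_inv bij_fun }.

HB.instance Definition _ := gen_eqMixin bijection.
HB.instance Definition _ := gen_choiceMixin bijection.

(** A two-sided inverse is determined by its map, and the cancellation proofs agree by proof
    irrelevance. *)
Lemma bijectionP (p q : bijection) : bij_fun p =1 bij_fun q -> p = q.
Proof.
case: p q => f f' fK f'K [g g' gK g'K] /= /funext fg; subst g.
have fg' : f' = g' by apply/funext => x; rewrite -{1}[x]g'K fK.
by subst g'; congr Bijection; exact: Prop_irrelevance.
Qed.

Definition bij_one := @Bijection id id (fun=> erefl) (fun=> erefl).
Definition bij_mul p q := Bijection
  (can_comp (bij_funK p) (bij_funK q)) (can_comp (bij_invK q) (bij_invK p)).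
Definition bij_opp p := Bijection (bij_invK p) (bij_funK p).

Lemma bij_mulA : associative bij_mul.
Proof. by move=> p q r; exact: bijectionP. Qed.
Lemma bij_mul1 : left_id bij_one bij_mul.
Proof. by move=> p; exact: bijectionP. Qed.
Lemma bij_mulr1 : right_id bij_one bij_mul.
Proof. by move=> p; exact: bijectionP. Qed.
Lemma bij_mulV : left_inverse bij_one bij_opp bij_mul.
Proof. by move=> p; apply: bijectionP => x; exact: bij_funK. Qed.
Lemma bij_mulVr : right_inverse bij_one bij_opp bij_mul.
Proof. by move=> p; apply: bijectionP => x; exact: bij_invK. Qed.

HB.instance Definition _ := isGroup.Build bijection
  bij_mulA bij_mul1 bij_mulr1 bij_mulV bij_mulVr.

Lemma bij_funM (p q : bijection) x :
  bij_fun (p * q) x = bij_fun p (bij_fun q x).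
Proof. by []. Qed.

End Bijections.

(** * Universal properties of quotients, free groups and free products *)

Lemma morph_invg (G K : groupType) (f : G -> K) :
  {morph f : x y / x * y} -> {morph f : x / x^-1}.
Proof. by move=> fM x; apply: (mulgI (f x)); rewrite -fM !mulgV morphM1. Qed.

(** Multiplicativity is asked on [H] alone because [phi] is meaningful only on [O]. *)
Lemma subgroup_image (G K : groupType) (f : G -> K) (H : set G) :
  subgroup H -> {in H &, {morph f : x y / x * y}} -> subgroup (f @` H).
Proof.
move=> [H1 HM HV] fM; have f1 : f 1 = 1.
  by apply: (mulgI (f 1)); rewrite -fM ?inE // !mulg1.
split; first by exists 1.
- move=> _ _ [x Hx <-] [y Hy <-]; exists (x * y); first exact: HM.
  by rewrite fM ?inE.
- move=> _ [x Hx <-]; exists x^-1; first exact: HV.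
  by apply: (mulgI (f x)); rewrite -fM ?inE ?mulgV //; exact: HV.
Qed.

(** The kernel of [f] is a normal subgroup containing [S], hence contains the normal closure; so [f]
    is constant on cosets and can be evaluated at representatives. *)
Lemma quot_lift (G K : groupType) (S : set G) (f : G -> K) :
    {morph f : x y / x * y} -> (forall x, S x -> f x = 1) ->
  exists2 F : quot_group S -> K,
    {morph F : x y / x * y} & forall x, F (quot_proj S x) = f x.
Proof.
move=> fM fS; have f1 := morphM1 fM; have fV := morph_invg fM.
have fE x y : quot_proj S x = quot_proj S y -> f x = f y.
  move=> /quot_projP xy; apply/eqP; rewrite eq_sym -(inj_eq (mulgI (f x)^-1)).
  rewrite mulVg -fV -fM; apply/eqP; apply: (xy [set z | f z = 1]); split=> //.
  split; first split=> //=.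
  - by move=> a b fa fb; rewrite fM fa fb mulg1.
  - by move=> a fa; rewrite fV fa invg1.
  - by move=> a b /= fa; rewrite conjgE !fM fa mul1g -fM mulVg.
have FE x : f (repr (quot_proj S x)) = f x.
  by apply: fE; rewrite /quot_proj reprK.
exists (fun a => f (repr a)) => // a b.
have [x <-] := quot_proj_surj a; have [y <-] := quot_proj_surj b.
by rewrite -quot_projM !FE fM.
Qed.

Section FreeLift.
Variables (X : choiceType) (K : groupType).

Definition letter_eval (f : X -> K) (l : X * bool) :=
  if l.2 then (f l.1)^-1 else f l.1.

Definition word_eval (f : X -> K) (s : seq (X * bool)) : K :=
  foldr (fun l z => letter_eval f l * z) 1 s.

Lemma word_eval_cat f s t :
  word_eval f (s ++ t) = word_eval f s * word_eval f t.
Proof. by elim: s => [|l s IHs] /=; rewrite ?mul1g // IHs mulgA. Qed.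

Lemma word_eval_eqv f s t : free_eqv s t -> word_eval f s = word_eval f t.
Proof.
elim=> // [u v w _ -> _ -> //|s1 [x b] s2].
rewrite !word_eval_cat /= mulg1 /letter_eval /=.
by case: b => /=; rewrite ?(mulVg, mulgV) mul1g.
Qed.

Lemma free_lift f : exists2 F : free_group X -> K,
  {morph F : x y / x * y} & forall s, F (free_word s) = word_eval f s.
Proof.
have FE s : word_eval f (repr (free_word s)) = word_eval f s.
  exact/word_eval_eqv/repr_free_word.
exists (fun a => word_eval f (repr a)) => // a b.
have [s <-] := free_word_surj a; have [t <-] := free_word_surj b.
by rewrite -free_word_cat !FE word_eval_cat.
Qed.

End FreeLift.

Section IntPower.
Variables (K : groupType) (t : K).

Definition expgz (i : int) : K :=
  match i with Posz n => t ^+ n | Negz n => t ^- n.+1 end.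

Lemma expgz_succ i : expgz (1 + i)%R = t * expgz i.
Proof.
(* [Negz n] is -(n + 1), so -1 is a separate case: its successor leaves the negative branch. *)
case: i => [n|[|n]].
- by rewrite -PoszD /= expgS.
- by rewrite /= expg1 mulgV.
- rewrite (_ : (1 + Negz n.+1)%R = Negz n); last first.
    by rewrite !NegzE -(addn1 n.+1) PoszD GRing.opprD GRing.addrCA GRing.subrr
               GRing.addr0.
  by rewrite /= [t ^+ n.+2]expgSr invgM mulVKg.
Qed.

Lemma expgz_pred i : expgz (-1 + i)%R = t^-1 * expgz i.
Proof.
by rewrite -{2}(GRing.addrNK 1%R i) [(i - 1 + 1)%R]GRing.addrC expgz_succ mulKg
           GRing.addrC.
Qed.

(** This is how balance is used: with all generators sent to [t], a word of exponent sum 0 evaluates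
    to 1. *)
Lemma word_eval_expgz (X : choiceType) (s : seq (X * bool)) :
  word_eval (fun=> t) s = expgz (word_exponent_sum s).
Proof.
rewrite /word_exponent_sum; elim: s => [|[x b] s IHs]; first by rewrite big_nil.
rewrite big_cons /= IHs /letter_eval /=.
by case: b; rewrite ?expgz_succ ?expgz_pred.
Qed.

End IntPower.

Lemma free_prod_lift (A B K : groupType) (f : A -> K) (g : B -> K) :
    {morph f : x y / x * y} -> {morph g : x y / x * y} ->
  exists2 F : free_prod A B -> K, {morph F : x y / x * y} &
    (forall a, F (free_prod_inl B a) = f a) /\
    (forall b, F (free_prod_inr A b) = g b).
Proof.
move=> fM gM.
pose h (c : A + B) := match c with inl a => f a | inr b => g b end.
have [F FM FE] := free_lift h.
have Fg c : F (free_gen c) = h c.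
  by rewrite FE /= mulg1.
have [|F' F'M F'E] := @quot_lift _ _ (@free_prod_relators A B) F FM.
  move=> _ [] [a _ [b _ <-]]; rewrite !FM (morph_invg FM) !Fg /h.
    by rewrite fM mulgV.
  by rewrite gM mulgV.
by exists F' => //; split=> c; rewrite F'E Fg.
Qed.

(** * Homomorphisms out of [Gphi] *)

Section GphiLift.
Variables (X : choiceType) (R : set (free_group X)) (U : topologicalGroupType).
Variables (O : set U) (phi : U -> U) (K : groupType) (f : U -> K) (t : K).
Hypotheses (R_balanced : balanced_relators R) (fM : {morph f : x y / x * y}).
Hypothesis ft : forall w, O w -> t * f w = f (phi w) * t.

Definition Gphi_gen (x : X) : Gphi R O phi :=
  quot_proj _ (HNN_free O phi (free_gen x)).

(** A map on the free product descends twice: [ft] kills the HNN relators, and each relator in [R]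
    goes to [t] to the power 0. *)
Lemma Gphi_lift : exists2 F : Gphi R O phi -> K, {morph F : x y / x * y} &
  (forall u, F (Gphi_base R O phi u) = f u) /\ (forall x, F (Gphi_gen x) = t).
Proof.
have [g gM gE] := free_lift (fun _ : X => t).
have gg x : g (free_gen x) = t by rewrite gE /= mulg1.
have [F1 F1M [F1l F1r]] := free_prod_lift fM gM.
have [|F2 F2M F2E] := @quot_lift _ _ (@HNN_relators X U O phi) F1 F1M.
  move=> _ [x _ [w Ow <-]].
  rewrite !F1M !(morph_invg F1M) !F1l F1r gg ft //.
  by rewrite mulgK mulgV.
have [|F3 F3M F3E] := @quot_lift _ _ (@HNN_free X U O phi @` R) F2 F2M.
  move=> _ [r Rr <-]; rewrite F2E F1r -[r]reprK gE word_eval_expgz.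
  by rewrite -[word_exponent_sum _]/(exponent_sum r) (R_balanced Rr).
exists F3 => //; split=> [u|x]; rewrite F3E F2E ?F1l //.
by rewrite F1r gg.
Qed.

End GphiLift.

(** * Representatives of right cosets *)

Section Transversal.
Variable G : groupType.
Implicit Type H : set G.

(** [r x] is the chosen representative of the right coset [H x]. *)
Definition right_transversal H (r : G -> G) :=
  (forall x, H (x * (r x)^-1)) /\ (forall h x, H h -> r (h * x) = r x).

Lemma right_transversal_exists H :
  subgroup H -> exists r, right_transversal H r.
Proof.
(* The set is the coset [H x], so the choice depends on the coset only; it contains [x], so the
   default 1 is never taken. *)
move=> [H1 HM HV]; exists (fun x => xget 1 [set y | H (x * y^-1)]); split.
  move=> x; by case: xgetP => [y _ //|/(_ x)]; rewrite /= mulgV.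
move=> h x Hh; congr xget; apply/seteqP; split=> y /= Hy; last first.
  by rewrite -mulgA; apply: HM.
by rewrite -(mulKg h x) -mulgA; apply: HM => //; exact: HV.
Qed.

Lemma right_transversal_id H r x :
  right_transversal H r -> r (r x) == r x.
Proof.
by move=> [rH rM]; rewrite -(rM (x * (r x)^-1) (r x)) ?mulgVK.
Qed.

End Transversal.

(** * The action on tapes *)

Section Tape.
Variable G : groupType.

(** For a transversal [r] these are exactly the chosen representatives; the boolean equation makes
    them a subtype, compared by values. *)
Definition fixpoint (r : G -> G) := {x : G | r x == x}.
Definition tape (r1 r2 : G -> G) : Type :=
  G * (nat -> fixpoint r1) * (nat -> fixpoint r2).

Definition push (T : Type) (a : T) (f : nat -> T) (n : nat) :=
  if n is m.+1 then f m else a.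

(** Swapping the two half-tapes turns the inverse of a move into the move for the inverse of
    [phi]. *)
Definition tape_swap r1 r2 (s : tape r1 r2) : tape r2 r1 := (s.1.1, s.2, s.1.2).

Definition tape_move (phi r1 r2 : G -> G) (r1_id : forall x, r1 (r1 x) == r1 x)
    (s : tape r1 r2) : tape r1 r2 :=
  let: (u, f, g) := s in
  (phi (u * (r1 u)^-1) * val (g 0%N), push (exist _ (r1 u) (r1_id u)) f,
   fun n => g n.+1).

(** The new head is [phi] of an element of [O], hence in [P], times a representative [b]; so [r2]
    recovers [b], and [psi] then recovers the element of [O]. *)
Lemma tape_moveK (O P : set G) (phi psi r1 r2 : G -> G)
    (r1_id : forall x, r1 (r1 x) == r1 x)
    (r2_id : forall x, r2 (r2 x) == r2 x) :
    right_transversal O r1 -> right_transversal P r2 ->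
    (forall w, O w -> P (phi w)) -> (forall w, O w -> psi (phi w) = w) ->
  cancel (@tape_move phi r1 r2 r1_id)
    (fun s => tape_swap (tape_move psi r2_id (tape_swap s))).
Proof.
move=> [r1O _] [_ r2M] OP phiK [[u f] g] /=.
have r2E : r2 (phi (u * (r1 u)^-1) * val (g 0%N)) = val (g 0%N).
  by rewrite r2M; [exact/eqP/(valP (g 0%N)) | exact: OP].
rewrite /tape_swap /=; congr (_, _, _).
  by rewrite r2E mulgK phiK // mulgVK.
by apply/funext => -[|n] //=; apply: val_inj.
Qed.

Definition tape_translate r1 r2 (u : G) (s : tape r1 r2) : tape r1 r2 :=
  (u * s.1.1, s.1.2, s.2).

Lemma tape_translateK r1 r2 u :
  cancel (@tape_translate r1 r2 u) (tape_translate u^-1).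
Proof. by case=> [[v f] g]; rewrite /tape_translate /= mulKg. Qed.

Lemma tape_translateVK r1 r2 u :
  cancel (@tape_translate r1 r2 u^-1) (tape_translate u).
Proof. by case=> [[v f] g]; rewrite /tape_translate /= mulVKg. Qed.

Definition tape_action r1 r2 (u : G) : bijection (tape r1 r2) :=
  Bijection (tape_translateK u) (tape_translateVK u).

Lemma tape_actionM r1 r2 : {morph @tape_action r1 r2 : u v / u * v}.
Proof.
move=> u v; apply: bijectionP => -[[w f] g].
by rewrite bij_funM /= /tape_translate /= mulgA.
Qed.

(** The last two clauses detect, inside [K], membership in [O] and in its image from conjugation by
    [t]. *)
Lemma HNN_representation (O : set G) (phi : G -> G) : subgroup O ->
    {in O &, {morph phi : x y / x * y}} -> {in O &, injective phi} ->
  exists (K : groupType) (f : G -> K) (t : K),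
    [/\ {morph f : x y / x * y}, forall w, O w -> t * f w = f (phi w) * t,
        forall u v, t * f u = f v * t -> O u &
        forall u v, f u * t = t * f v -> (phi @` O) u].
Proof.
move=> sO phiM phiI; have [O1 OM OV] := sO.
have sP := subgroup_image sO phiM.
have [r1 tr1] := right_transversal_exists sO.
have [r2 tr2] := right_transversal_exists sP.
have r1_id x : r1 (r1 x) == r1 x by exact: right_transversal_id tr1.
have r2_id x : r2 (r2 x) == r2 x by exact: right_transversal_id tr2.
(* The inverse of [phi] on its image, with the junk value 1 elsewhere. *)
pose psi x := xget 1 [set w | O w /\ phi w = x].
have psiP x : (phi @` O) x -> O (psi x) /\ phi (psi x) = x.
  by move=> [w Ow wx]; rewrite /psi; case: xgetP => [y -> //|/(_ w)[]].
have phiK w : O w -> psi (phi w) = w.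
  move=> Ow; have [|Oy /phiI] := psiP (phi w); first by exists w.
  by apply; rewrite inE.
have moveK : cancel (tape_move phi r1_id) _ :=
  tape_moveK r1_id r2_id tr1 tr2 (fun w Ow => imageP phi Ow) phiK.
have moveVK := tape_moveK r2_id r1_id tr2 tr1
  (fun x Px => (psiP x Px).1) (fun x Px => (psiP x Px).2).
have moveK' : cancel
    (fun s => tape_swap (tape_move psi r2_id (tape_swap s)))
    (tape_move phi r1_id).
  by move=> [[u f] g]; have := congr1 (@tape_swap _ _) (moveVK (u, g, f)).
pose f := @tape_action r1 r2; pose t := Bijection moveK moveK'.
have [r1O r1M] := tr1.
have tE u s : bij_fun (t * f u) s =
    tape_move phi r1_id (tape_translate u s) by [].
have Et u s : bij_fun (f u * t) s =
    tape_translate u (tape_move phi r1_id s) by [].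
(* Constant tapes are filled with the representatives of the trivial cosets, which may differ from
   1. *)
pose a0 : fixpoint r1 := exist _ (r1 1) (r1_id 1).
pose b0 : fixpoint r2 := exist _ (r2 1) (r2_id 1).
pose s0 : tape r1 r2 := (1, fun=> a0, fun=> b0).
exists (bijection (tape r1 r2)), f, t; split.
- exact: tape_actionM.
- move=> w Ow; apply: bijectionP => -[[u h] k].
  rewrite tE Et /tape_translate /=; congr (_, push _ _, _).
    by rewrite r1M // mulgA -phiM ?inE // mulgA.
  by apply: val_inj; rewrite /= r1M.
(* The first cells of the left half-tapes give [r1 u = r1 1], so [u] lies in the coset of 1, which
   is [O]. *)
- move=> u v /(congr1 (fun p => bij_fun p s0)).
  rewrite tE Et /tape_translate /= mulg1 => -[_].
  move=> /(congr1 (fun h => val (h 0%N))) /= r1u.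
  have := OM _ _ (r1O u) (OV _ (r1O 1)).
  by rewrite r1u mul1g invgK mulgVK.
(* Comparing heads and cancelling [r2 1] expresses [u] as a quotient of two elements of the image of
   [phi]. *)
- move=> u v /(congr1 (fun p => bij_fun p s0)).
  rewrite tE Et /tape_translate /= !mulg1 => -[E _].
  have O1' := r1O 1; rewrite mul1g in O1'.
  have P1 : (phi @` O) (phi (r1 1)^-1) by exists (r1 1)^-1.
  have Pv : (phi @` O) (phi (v * (r1 v)^-1)) by exists (v * (r1 v)^-1).
  have [_ PM PV] := sP; move: E; rewrite mul1g mulgA => /mulIg E.
  have -> : u = phi (v * (r1 v)^-1) * (phi (r1 1)^-1)^-1 by rewrite -E mulgK.
  by apply: PM => //; exact: PV.
Qed.

End Tape.

(** * Normality of the image of [U] in [Gphi] *)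

Section GphiNormality.
Variables (X : choiceType) (R : set (free_group X)) (U : topologicalGroupType).
Variables (O : set U) (phi : U -> U).
Local Notation base := (Gphi_base R O phi).
Local Notation gen := (@Gphi_gen X R U O phi).

Lemma Gphi_baseM : {morph base : u v / u * v}.
Proof. by move=> u v; rewrite /Gphi_base gmulfM quot_projM. Qed.

Lemma Gphi_rel x w : O w -> gen x * base w = base (phi w) * gen x.
Proof.
move=> Ow; rewrite /Gphi_gen /Gphi_base -[LHS]quot_projM -[RHS]quot_projM.
by congr quot_proj; rewrite -(HNN_rel phi x Ow) conjgE invgK !mulgA mulgVK.
Qed.

Lemma range_Gphi_base_subgroup : subgroup (range base).
Proof.
apply: (@subgroup_image _ _ base setT); first by split.
by move=> u v _ _; exact: Gphi_baseM.
Qed.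

Lemma Gphi_ind (K : set (Gphi R O phi)) : subgroup K ->
  (forall u, K (base u)) -> (forall x, K (gen x)) -> K = setT.
Proof.
move=> sK Ku Kt; apply/seteqP; split=> // c _.
have [h <-] := quot_proj_surj c.
suff E : @quot_proj _ (@HNN_free X U O phi @` R) @^-1` K = setT.
  by have : [set: HNN X O phi] h by []; rewrite -E.
by apply: HNN_ind => //; exact: subgroup_preimage.
Qed.

Lemma range_Gphi_base_normal : O = setT -> phi @` O = setT ->
  normal_subgroup (range base).
Proof.
move=> OT phiT; have sB := range_Gphi_base_subgroup; have [B1 BM BV] := sB.
split=> // x y Bx; move: x Bx.
(* Conjugation by both [y] and its inverse is required so that these [y] form a subgroup; checking
   generators then suffices. *)
suff E : [set y | (forall x, range base x -> range base (x ^ y)) /\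
    (forall x, range base x -> range base (x ^ y^-1))] = setT.
  by have : [set: Gphi R O phi] y by []; rewrite -E => -[].
apply: Gphi_ind => [|u|t].
- split=> [|y1 y2 [B1y B1yV] [B2y B2yV]|y1 [By ByV]] /=.
  + by rewrite invg1; split=> x; rewrite conjg1.
  + rewrite invgM; split=> x Bx; rewrite conjgM.
      exact/B2y/B1y.
    exact/B1yV/B2yV.
  + by rewrite invgK.
- have Bu : range base (base u) by exists u.
  split=> x Bx; rewrite conjgE ?invgK.
    exact: BM (BV _ Bu) (BM _ _ Bx Bu).
  exact: BM Bu (BM _ _ Bx (BV _ Bu)).
(* Conjugation by the inverse of [gen t] uses [O = setT]; conjugation by [gen t] uses that [phi] is
   onto. *)
- split=> _ [u _ <-]; last first.
    exists (phi u) => //; apply: (mulIg (gen t)); rewrite -Gphi_rel ?OT //.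
    by rewrite conjgE invgK mulgA mulgVK.
  have : (phi @` O) u by rewrite phiT.
  by move=> [w Ow <-]; exists w => //; rewrite conjgE -Gphi_rel // mulKg.
Qed.

(** Normality puts both conjugates of [base u] by the stable letter of [x0] back in the image of
    [U]; their images under [F] are the equations that the representation detects. *)
Lemma range_Gphi_base_normal_inv (x0 : X) :
    balanced_relators R -> subgroup O ->
    {in O &, {morph phi : x y / x * y}} -> {in O &, injective phi} ->
  normal_subgroup (range base) -> O = setT /\ phi @` O = setT.
Proof.
move=> R_balanced sO phiM phiI [_ BJ].
have [K [f [t [fM ft fO fP]]]] := HNN_representation sO phiM phiI.
have [F FM [Fb Fg]] := Gphi_lift R_balanced fM ft.
have Bb u : range base (base u) by exists u.
split; apply/seteqP; split=> // u _.
  have [v _ E] := BJ _ (gen x0)^-1 (Bb u); apply: (fO u v).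
  by rewrite -!Fb E -(Fg x0) -!FM conjgE invgK mulgA mulgVK.
have [v _ E] := BJ _ (gen x0) (Bb u); apply: (fP u v).
by rewrite -!Fb E -(Fg x0) -!FM conjgE mulVKg.
Qed.

End GphiNormality.

Theorem proposition3p17
    (X : finType) (X_nonempty : (0 < #|X|)%N)
    (R : set (free_group X)) (R_balanced : balanced_relators R)
    (U : topologicalGroupType) (U_hausdorff : hausdorff_space U)
    (O : set U) (O_subgroup : subgroup O) (O_open : open O)
    (phi : U -> U) (phi_mono : continuous_open_mono O phi) :
  (O = [set: U] /\ phi @` O = [set: U]) <->
  normal_closure (range (Gphi_base R O phi)) = range (Gphi_base R O phi).
Proof.
split=> [[OT phiT]|E].
  apply/seteqP; split; last exact: sub_normal_closure.
  by apply: normal_closure_min => //; exact: range_Gphi_base_normal.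
(* A stable letter must exist: without one [Gphi] would reduce to [U], normal whatever [O] is. *)
have [phiM phiI _ _] := phi_mono; have /card_gt0P[x0 _] := X_nonempty.
apply: (range_Gphi_base_normal_inv x0 R_balanced O_subgroup phiM phiI).
by rewrite -E; exact: normal_closure_normal.
Qed.
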